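(* For any graph $G$, there exists a set $D\subseteq V(G)$ with $\partial_s(D)=\partial_s(G)$ which is a dominating set of $G$.
   Context: Graphs are finite, simple, undirected, with non-empty vertex set; $N(v)$ is the open neighbourhood of $v$. For $D\subseteq V(G)$: $N_e(D)=\{u\in V(G)\setminus D:\ N(u)\cap D\ne\varnothing\}$; for $v\in D$, $\mathrm{epn}(v,D)=\{u\in V(G)\setminus D:\ N(u)\cap D=\{v\}\}$; $D_w=\{v\in D:\ \mathrm{epn}(v,D)\neq\varnothing\}$. The strong differential of $D$ is $\partial_s(D)=|N_e(D)|-|D_w|$, and the strong differential of $G$ is $\partial_s(G)=\max\{\partial_s(D):\ D\subseteq V(G)\}$. A set $S\subseteq V(G)$ is a dominating set if $N(v)\cap S\neq\varnothing$ for every $v\in V(G)\setminus S$. *)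

(* Defs.v *)
From mathcomp Require Export all_boot all_order all_algebra.

Set Implicit Arguments.
Unset Strict Implicit.
Unset Printing Implicit Defensive.

Import Order.TTheory GRing.Theory Num.Theory.
Local Open Scope ring_scope.

(* A graph is given by its vertex type T and its adjacency relation e; the
   hypotheses making it simple (symmetric e, irreflexive e) and non-empty are
   carried by the statements. *)
Section StrongDifferential.
Variables (T : finType) (e : rel T).
Implicit Types (v : T) (D S : {set T}).

Definition open_nbhd v : {set T} := [set u | e v u].

Definition ext_nbhd D : {set T} :=
  [set u in ~: D | open_nbhd u :&: D != set0].

Definition epn v D : {set T} :=
  [set u in ~: D | open_nbhd u :&: D == [set v]].

Definition weak_part D : {set T} := [set v in D | epn v D != set0].

(* Valued in int, so that the subtraction is not truncated. *)
Definition strong_diff_set D : int :=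
  #|ext_nbhd D|%:Z - #|weak_part D|%:Z.

(* The default value of the iterated maximum is that of the subset set0, so
   this is the maximum over the subsets of T. *)
Definition strong_diff : int :=
  \big[Num.max/strong_diff_set set0]_(D : {set T}) strong_diff_set D.

Definition dominating S : Prop :=
  forall v, v \notin S -> open_nbhd v :&: S != set0.

End StrongDifferential.

(* Main.v *)
Require Import Defs.
From mathcomp Require Import all_boot all_order all_algebra.

Set Implicit Arguments.
Unset Strict Implicit.
Unset Printing Implicit Defensive.

Import Order.TTheory GRing.Theory Num.Theory.

(** Take an optimal [D] of maximum cardinality. If [x] were undominated, passing
    to [x |: D] keeps all external neighbours and creates no weak vertex other
    than [x]; and if [x] is weak, its external private neighbours are new
    external neighbours, which pay for it. So [x |: D] is a larger optimal set. *)

Section AddUndominated.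
Variables (T : finType) (e : rel T) (D : {set T}) (x : T).
Hypotheses (xND : x \notin D) (x_undom : open_nbhd e x :&: D = set0).

(** Only [x] itself could be lost, and having no neighbour in [D] it was never an external
    neighbour. *)
Lemma ext_nbhd_setU1 : ext_nbhd e D \subset ext_nbhd e (x |: D).
Proof.
apply/subsetP=> u; rewrite !inE => /andP[uND /set0Pn[v /setIP[uv vD]]].
rewrite negb_or uND andbT; apply/andP; split.
  by apply/eqP=> ux; move/setP/(_ v): x_undom; rewrite -ux in_setI uv vD in_set0.
by apply/set0Pn; exists v; rewrite in_setI uv in_setU1 vD orbT.
Qed.

Lemma epn_setU1_sub v : v \in D -> epn e v (x |: D) \subset epn e v D.
Proof.
move=> vD; apply/subsetP=> u; rewrite !inE negb_or => /andP[/andP[_ ->]] /eqP uv /=.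
(* The trace on [x |: D] is [[set v]]; cutting it down to [D] keeps [v], since [v \in D]. *)
have -> : open_nbhd e u :&: D = open_nbhd e u :&: (x |: D) :&: D.
  by rewrite -setIA (setIidPr (subsetUr [set x] D)).
by rewrite uv; apply/eqP/setIidPl; rewrite sub1set.
Qed.

Lemma weak_part_setU1_sub :
  weak_part e (x |: D) \subset x |: weak_part e D.
Proof.
apply/subsetP=> v; rewrite in_set => /andP[/setU1P[->|vD] /set0Pn[u uv]].
  exact: setU11.
apply/setU1r; rewrite in_set vD; apply/set0Pn; exists u.
exact: (subsetP (epn_setU1_sub vD)).
Qed.

(** A vertex whose only neighbour in [x |: D] is [x] has none in [D], because [x \notin D]. *)
Lemma epn_setU1_new : epn e x (x |: D) \subset ext_nbhd e (x |: D) :\: ext_nbhd e D.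
Proof.
apply/subsetP=> u; rewrite in_set => /andP[uND /eqP ux].
have uD0 : open_nbhd e u :&: D = set0.
  rewrite -(setIidPr (subsetUr [set x] D)) setIA ux.
  by apply/disjoint_setI0; rewrite disjoints1.
rewrite in_setD 2!in_set uD0 eqxx andbF in_set ux uND /=.
by apply/set0Pn; exists x; rewrite set11.
Qed.

Lemma strong_diff_setU1 :
  (strong_diff_set e D <= strong_diff_set e (x |: D))%R.
Proof.
(* Moving the weak parts across leaves an inequality in [nat]: old external plus new weak is at most
   new external plus old weak. *)
rewrite /strong_diff_set lerBlDr addrAC lerBrDr -!PoszD lez_nat.
have [xW | xNW] := boolP (x \in weak_part e (x |: D)).
  have lt_ext : #|ext_nbhd e D| < #|ext_nbhd e (x |: D)|.
    apply: proper_card; rewrite properE ext_nbhd_setU1 /=.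
    move: xW; rewrite in_set => /andP[_ /set0Pn[u /(subsetP epn_setU1_new)]].
    by case/setDP=> u_new u_old; apply/subsetPn; exists u.
  have le_weak : #|weak_part e (x |: D)| <= #|weak_part e D|.+1.
    apply: leq_trans (subset_leq_card weak_part_setU1_sub) _.
    by rewrite cardsU1 -add1n leq_add2r leq_b1.
  by rewrite (leq_trans (leq_add (leqnn _) le_weak)) // addnS -addSn leq_add2r.
apply: leq_add; first exact: subset_leq_card ext_nbhd_setU1.
apply/subset_leq_card/subsetP=> v vW.
(* The case [v = x] would make [x] weak, against [xNW]. *)
have /setU1P[vx|//] := subsetP weak_part_setU1_sub v vW.
by case/negP: xNW; rewrite -{1}vx.
Qed.

End AddUndominated.

(** Being attained passes to the larger of two values, and the default value is attained at
    [set0]. *)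
Lemma strong_diff_attained (T : finType) (e : rel T) :
  exists D : {set T}, strong_diff_set e D == strong_diff e.
Proof.
rewrite /strong_diff; elim/big_ind: _ => [|a b|D _].
- by exists set0.
- by case: (leP a b).
- by exists D.
Qed.

Theorem lemma3p1 (T : finType) (e : rel T)
    (e_sym : symmetric e) (e_irr : irreflexive e) (T_gt0 : (0 < #|T|)%N) :
  exists D : {set T},
    strong_diff_set e D = strong_diff e /\ dominating e D.
Proof.
have [D0 optD0] := strong_diff_attained e.
have [D /eqP optD maxD] :=
  @arg_maxnP _ D0 (fun D => strong_diff_set e D == strong_diff e)
    (fun D => #|D|) optD0.
exists D; split=> // x xND; apply/negP=> /eqP x_undom.
(* [x |: D] is optimal too, so [maxD] bounds its cardinality by that of [D], which is absurd. *)
have /maxD /= : strong_diff_set e (x |: D) == strong_diff e.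
  by rewrite eq_le -{2}optD strong_diff_setU1 // andbT le_bigmax.
by rewrite cardsU1 xND add1n ltnn.
Qed.
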